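(* (a) If $$f_a(n)=2\left\lfloor\frac{n-1}{2}\right\rfloor=n-\frac{3+(-1)^n}{2}\quad\text{for all } n\in\mathbb{N},$$ then the corresponding sequence $q_a=Q(f_a)$ exists and $$q_a(n)=n-\frac{1+(-1)^n}{2}\quad\text{for all } n\in\mathbb{N}.$$ (b) If $$f_b(n)=\frac{1+(-1)^n}{2}\quad\text{for all } n\in\mathbb{N},$$ then the corresponding sequence $q_b=Q(f_b)$ exists and $$q_b(n)=\frac{3+(-1)^n}{2}\quad\text{for all } n\in\mathbb{N}.$$
   Context: $\mathbb{N}=\{1,2,3,\dots\}$; all sequences start at index $1$. For an integer sequence $f$ with $f(1)=0$, the corresponding sequence $q=Q(f)$ is defined by $q(1)=1$ and $q(n)=q(n-q(n-1))+f(n)$ for $n>1$. It is said to exist if $q(n)$ is defined for every $n\in\mathbb{N}$ (there are no values of $q$ at indices $\le 0$); equivalently, if $1\le q(n)\le n$ for all $n\in\mathbb{N}$. *)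

(* Defs.v *)
From HB Require Import structures.
From mathcomp Require Import all_boot all_order all_algebra.
Set Implicit Arguments.
Unset Strict Implicit.
Unset Printing Implicit Defensive.
Import Order.TTheory GRing.Theory Num.Theory.
Local Open Scope ring_scope.

(* Integer sequences indexed from 1 are functions nat -> int whose value at 0
   is never used.  Q(f) is a partial sequence, given by its graph: Qval f n v
   means that q(n) is defined and equal to v.  In Qval_rec the index
   k = n + 1 - q(n) must be one of those at which q was computed before; k = 0
   is excluded since no constructor yields a value at index 0. *)
Inductive Qval (f : nat -> int) : nat -> int -> Prop :=
| Qval_1 : Qval f 1 1
| Qval_rec (n k : nat) (a b : int) :
    Qval f n a ->
    k%:Z = n.+1%:Z - a ->
    (k <= n)%N ->
    Qval f k b ->
    Qval f n.+1 (b + f n.+1).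

Definition Qexists (f : nat -> int) : Prop :=
  forall n : nat, (0 < n)%N -> exists v : int, Qval f n v.

Lemma Qval_gt0 f n v : Qval f n v -> (0 < n)%N.
Proof. by case. Qed.

Lemma Qval_inv f n v : Qval f n.+1 v -> (0 < n)%N ->
  exists k a b, [/\ Qval f n a, k%:Z = n.+1%:Z - a, (k <= n)%N,
    Qval f k b & v = b + f n.+1].
Proof.
move=> H; inversion H as [|n' k a b Ha ek lk Hb]; subst => // _.
by exists k, a, b.
Qed.

Lemma Qval_fun f n v w : Qval f n v -> Qval f n w -> v = w.
Proof.
move=> H; elim: H w => {n v} [w H|n k a b Ha IHa ek lk Hb IHb w H].
  inversion H as [|n' k a b Ha]; subst => //.
  by have := Qval_gt0 Ha.
have [k' [a' [b' [Ha' ek' _ Hb' ->]]]] := Qval_inv H (Qval_gt0 Ha).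
rewrite -(IHa _ Ha') -ek in ek'; case: ek' => ek'.
by rewrite ek' in Hb'; rewrite (IHb _ Hb').
Qed.

Lemma Qexists_bounds f : Qexists f ->
  forall n v, Qval f n v -> 1 <= v <= n%:Z.
Proof.
move=> Hf n v Hv; have n0 := Qval_gt0 Hv.
have [w Hw] := Hf n.+1 isT.
have [k [a [b [Ha ek lk Hb _]]]] := Qval_inv Hw n0.
have k0 := Qval_gt0 Hb; rewrite (Qval_fun Hv Ha).
have -> : a = n.+1%:Z - k%:Z by rewrite ek opprB addrC subrK.
rewrite lerBrDr lerBlDr -!PoszD !lez_nat add1n ltnS lk /=.
by rewrite -addn1 leq_add2l.
Qed.

(* Main.v *)
Require Import Defs.
From HB Require Import structures.
From mathcomp Require Import all_boot all_order all_algebra.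
From mathcomp Require Import zify lra.
Set Implicit Arguments.
Unset Strict Implicit.
Unset Printing Implicit Defensive.
Import Order.TTheory GRing.Theory Num.Theory.
Local Open Scope ring_scope.

(** Guess the closed form and check it against the recursion: [Qval_closed_form] turns the check
    into existence, and [Qval_fun] makes the guess the only value. In both parts the recursion at n
    > 1 always looks back at a term equal to 1, so q(n) = 1 + f(n). In (a) the index looked up is 1
    or 2; in (b) it is always odd. *)

(** The bounds on [g] keep the index looked up between 1 and the preceding index, so strong
    induction supplies both values that [Qval_rec] needs, and the truncated subtraction is exact. *)
Lemma Qval_closed_form (f : nat -> int) (g : nat -> nat) :
  g 1%N = 1%N ->
  (forall n, (0 < n)%N -> (0 < g n <= n)%N) ->
  (forall n, (0 < n)%N -> (g n.+1)%:Z = (g (n.+1 - g n)%N)%:Z + f n.+1) ->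
  forall n, (0 < n)%N -> Qval f n (g n).
Proof.
move=> g1 g_bnd g_rec; elim/ltn_ind=> -[//|[|n]] IH _.
  by rewrite g1; exact: Qval_1.
have /andP[g_gt0 g_le] := g_bnd n.+1 isT.
rewrite g_rec //; apply: (@Qval_rec _ _ (n.+2 - g n.+1)%N).
- exact: IH.
- lia.
- lia.
- by apply: IH; lia.
Qed.

Lemma Qexists_closed_form (f : nat -> int) (g : nat -> nat) :
  (forall n, (0 < n)%N -> Qval f n (g n)) -> Qexists f.
Proof. by move=> Hg n n_gt0; exists (g n)%:Z; exact: Hg. Qed.

Lemma floor_half (m : nat) : Num.floor (m%:R / 2 : rat) = m./2.
Proof.
apply: floor_def; rewrite -[m in m%:R]odd_double_half -muln2 natrD natrM.
rewrite intrD /= -pmulrn.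
by case: (odd m) => /=; lra.
Qed.

(** Trades the sign for the parity bit used in the integer closed forms, leaving identities linear
    in that bit. *)
Lemma sign_even (n : nat) : (-1) ^+ n = 2 * (~~ odd n)%:R - 1 :> rat.
Proof. by rewrite -signr_odd; case: (odd n). Qed.

Theorem lemma2p1 :
  (forall fa : nat -> int,
    (forall n : nat, (0 < n)%N ->
       fa n = 2 * Num.floor ((n%:R - 1) / 2 : rat)) ->
    [/\ forall n : nat, (0 < n)%N ->
          (fa n)%:~R = n%:R - (3 + (-1) ^+ n) / 2 :> rat,
        fa 1%N = 0,
        Qexists fa
      & forall (n : nat) (v : int), (0 < n)%N -> Qval fa n v ->
          v%:~R = n%:R - (1 + (-1) ^+ n) / 2 :> rat])
  /\
  (forall fb : nat -> int,
    (forall n : nat, (0 < n)%N ->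
       (fb n)%:~R = (1 + (-1) ^+ n) / 2 :> rat) ->
    [/\ fb 1%N = 0,
        Qexists fb
      & forall (n : nat) (v : int), (0 < n)%N -> Qval fb n v ->
          v%:~R = (3 + (-1) ^+ n) / 2 :> rat]).
Proof.
split=> f Hf.
(* Twice the half of n - 1 is n - 1 minus its parity, and n - 1 is odd exactly when n is even. *)
- have fE n : (0 < n)%N -> f n = n%:Z - 1 - (~~ odd n)%:Z.
    case: n => // n _; rewrite Hf // -(natr1 n) addrK floor_half /=.
    by have := odd_double_half n; case: (odd n) => /=; lia.
  have HQ : forall n, (0 < n)%N -> Qval f n (n - ~~ odd n)%N.
    apply: (@Qval_closed_form f (fun n => n - ~~ odd n)%N) => // -[//|n] _.
      by move=> /=; case: n => // n; case: odd; lia.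
    (* The index looked up is 2 or 1 according to parity, and the closed form is 1 at both. *)
    rewrite fE //= negbK; case: (odd n) => /=.
      by have -> : (n.+2 - (n.+1 - 1) = 2)%N; lia.
    by have -> : (n.+2 - (n.+1 - 0) = 1)%N; lia.
  split; [| by rewrite fE | exact: Qexists_closed_form HQ |].
  + move=> n n_gt0; rewrite fE // !rmorphB /= -!pmulrn sign_even; lra.
  + move=> n v n_gt0 /Qval_fun/(_ (HQ n n_gt0)) ->.
    (* No truncation occurs, so the subtraction can be cast to [rat]. *)
    have le_n : (~~ odd n <= n)%N by case: n n_gt0 => // n _; case: odd.
    by rewrite -pmulrn natrB // sign_even; lra.
- have fE n : (0 < n)%N -> f n = (~~ odd n)%:Z.
    move=> n_gt0; apply/eqP; rewrite -(eqr_int rat) Hf // sign_even -pmulrn.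
    by apply/eqP; lra.
  have HQ : forall n, (0 < n)%N -> Qval f n (1 + ~~ odd n)%N.
    apply: (@Qval_closed_form f (fun n => 1 + ~~ odd n)%N) => // -[//|n] _.
      by case: n => // n; case: odd.
    (* The index is [n] for odd [n] and [n.+1] for even [n]. *)
    have -> : odd (n.+2 - (1 + ~~ odd n.+1)).
      by case Hn: (odd n) => /=; rewrite Hn; lia.
    by rewrite fE.
  split; [by rewrite fE | exact: Qexists_closed_form HQ |].
  move=> n v n_gt0 /Qval_fun/(_ (HQ n n_gt0)) ->.
  by rewrite -pmulrn natrD sign_even; lra.
Qed.
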